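(* Every non-copying transduction $\mathsf T$ is subsumed by the composition of an immersive transduction $\mathsf T_{\rm imm}$ and a perturbation $\mathsf P$, that is, $\mathsf T\leq \mathsf P\circ\mathsf T_{\rm imm}$. Consequently, every transduction $\mathsf T$ is subsumed by the composition of a copying operation $\mathsf C$, an immersive transduction $\mathsf T_{\rm imm}$ and a perturbation $\mathsf P$, that is, $\mathsf T\leq \mathsf P\circ\mathsf T_{\rm imm}\circ\mathsf C$.
   Context: Graphs are finite, undirected and loopless. For a set $\mathcal U$ of unary relation symbols, a $\mathcal U$-colored graph is a graph together with additional unary relations in $\mathcal U$. Formulas are first-order, with adjacency relation $E$. Transductions. For a positive integer $k$, the $k$-copy operation $\mathsf C_k$ maps a graph $G$ to the graph consisting of $k$ copies of $G$ in which the $k$ copies of each vertex are made pairwise adjacent (no other edges between the copies of $G$); $\mathsf C_1$ is the identity. The coloring operation $\Gamma_{\mathcal U}$ maps a graph $G$ to the set of all its $\mathcal U$-expansions (all $\mathcal U$-colored graphs whose underlying graph is $G$). A simple interpretation $\mathsf I=(\nu(x),\eta(x,y))$ of graphs in $\mathcal U$-colored graphs is a pair of first-order formulas in the language of $\mathcal U$-colored graphs with $\eta$ symmetric and anti-reflexive; $\mathsf I(G^+)$ is the graph with vertex set $\nu(G^+)$ and edge set $\eta(G^+)\cap\nu(G^+)^2$. A transduction is a composition $\mathsf T=\mathsf I\circ\Gamma_{\mathcal U}\circ\mathsf C_k$, i.e. $\mathsf T(G)=\{\mathsf I(G^+): G^+\in\Gamma_{\mathcal U}(\mathsf C_k(G))\}$.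 It is non-copying if it can be written with $k=1$. A copying operation is some $\mathsf C_k$. For a set $\mathcal{S}$ of graphs, $\mathsf T(\mathcal S)=\bigcup_{G\in\mathcal S}\mathsf T(G)$, which defines compositions. Subsumption. $\mathsf T\leq\mathsf T'$ ($\mathsf T'$ subsumes $\mathsf T$) means $\mathsf T(G)\subseteq\mathsf T'(G)$ for every graph $G$. Locality. For $U\subseteq V(G)$, $B_r^G(U)$ is the subgraph of $G$ induced by the vertices at distance at most $r$ from some vertex of $U$. A formula $\phi(x_1,\dots,x_k)$ is $r$-local if for every (colored) graph $G$ and all $v_1,\dots,v_k\in V(G)$, $G\models\phi(v_1,\dots,v_k)\iff B_r^G(\{v_1,\dots,v_k\})\models\phi(v_1,\dots,v_k)$. An $r$-local formula is strongly $r$-local if moreover $\models\phi(x_1,\dots,x_k)\rightarrow\mathrm{dist}(x_i,x_j)\leq r$ for all $i<j$. Strongly local means strongly $r$-local for some $r$. A transduction is immersive if it is non-copying and the formulas in its associated interpretation are strongly local. Perturbations. A subset complementation is the transduction that chooses a subset $M$ of vertices (a unary relation) and complements the adjacency inside $M$, i.e. it is defined (on the whole vertex set) by $\eta(x,y):=(x\neq y)\wedge\neg\bigl(E(x,y)\leftrightarrow(M(x)\wedge M(y))\bigr)$. A perturbation is a composition of a bounded number of subset complementations. *)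

(* Defs.v *)
From HB Require Import structures.
From mathcomp Require Import all_boot.

Set Implicit Arguments.
Unset Strict Implicit.
Unset Printing Implicit Defensive.

Record graph := Graph {
  vertex :> finType;
  adj : rel vertex;
  adj_sym : symmetric adj;
  adj_irr : irreflexive adj }.

Definition isomorphic (G H : graph) : Prop :=
  exists2 f : G -> H, bijective f & {mono f : x y / adj x y}.

Record cgraph (U : Type) := CGraph {
  underlying :> graph;
  color : U -> {set underlying} }.
Arguments color {U} c u.

(** [formula U n] has its free variables among [0, ..., n-1]; under
    [FExists], variable [0] is the quantified one and the others are shifted. *)
Inductive formula (U : Type) : nat -> Type :=
| FTrue n : formula U n
| FEq n of 'I_n & 'I_n : formula U n
| FAdj n of 'I_n & 'I_n : formula U n
| FCol n of U & 'I_n : formula U n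
| FNot n of formula U n : formula U n
| FAnd n of formula U n & formula U n : formula U n
| FExists n of formula U n.+1 : formula U n.

Arguments FTrue {U n}.
Arguments FEq {U n}.
Arguments FAdj {U n}.
Arguments FCol {U n}.
Arguments FNot {U n}.
Arguments FAnd {U n}.
Arguments FExists {U n}.

Definition FImp U n (f g : formula U n) := FNot (FAnd f (FNot g)).
Definition FIff U n (f g : formula U n) := FAnd (FImp f g) (FImp g f).

Definition env1 (V : Type) (x : V) : 'I_1 -> V := fun=> x.

Definition env_cons (V : Type) n (x : V) (v : 'I_n -> V) : 'I_n.+1 -> V :=
  fun i => if unlift ord0 i is Some j then v j else x.

Definition env2 (V : Type) (x y : V) : 'I_2 -> V := env_cons x (env1 y).

Fixpoint sat (U : Type) (G : cgraph U) n (f : formula U n) :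
    ('I_n -> G) -> bool :=
  match f in formula _ n return ('I_n -> G) -> bool with
  | FTrue _ => fun v => true
  | FEq _ i j => fun v => v i == v j
  | FAdj _ i j => fun v => adj (v i) (v j)
  | FCol _ u i => fun v => v i \in color G u
  | FNot _ g => fun v => ~~ sat g v
  | FAnd _ g h => fun v => sat g v && sat h v
  | FExists _ g => fun v => [exists x, sat g (env_cons x v)]
  end.

(** Nondeterministic maps: [F a b] reads "b belongs to F(a)". Sets of graphs
    are taken up to isomorphism, so that the operations below which output
    graphs output all isomorphic copies. *)
Definition multimap (A B : Type) := A -> B -> Prop.
Definition operation := multimap graph graph.

Definition comp A B C (S : multimap B C) (T : multimap A B) : multimap A C :=
  fun a c => exists2 b, T a b & S b c.

Notation "S ∘ T" := (comp S T) (at level 40, left associativity).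

Definition same_op (S T : operation) : Prop := forall G H, S G H <-> T G H.

Definition subsumed (T T' : operation) : Prop := forall G H, T G H -> T' G H.

Section Copy.
Variables (k : nat) (G : graph).

Definition copy_adj : rel (G * 'I_k) := fun a b =>
  if a.2 == b.2 then adj a.1 b.1 else a.1 == b.1.

Lemma copy_adj_sym : symmetric copy_adj.
Proof.
by move=> a b; rewrite /copy_adj [b.2 == _]eq_sym [b.1 == _]eq_sym adj_sym.
Qed.

Lemma copy_adj_irr : irreflexive copy_adj.
Proof. by move=> a; rewrite /copy_adj eqxx adj_irr. Qed.

Definition copy : graph := Graph copy_adj_sym copy_adj_irr.
End Copy.

Definition copy_op (k : nat) : operation := fun G H => isomorphic (copy k G) H.

Definition copying_operation (C : operation) : Prop :=
  exists2 k, 0 < k & same_op C (copy_op k).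

Definition coloring_op (U : Type) : multimap graph (cgraph U) :=
  fun G Gc => underlying Gc = G.

Record interpretation (U : Type) := Interpretation {
  nu : formula U 1;
  eta : formula U 2;
  eta_sym : forall G : cgraph U, symmetric (fun x y : G => sat eta (env2 x y));
  eta_irr : forall G : cgraph U,
    irreflexive (fun x y : G => sat eta (env2 x y)) }.

Section Interpret.
Variables (U : Type) (I : interpretation U) (G : cgraph U).

Definition interp_vertex : finType := {x : G | sat (nu I) (env1 x)}.

Definition interp_adj : rel interp_vertex :=
  fun a b => sat (eta I) (env2 (val a) (val b)).

Lemma interp_adj_sym : symmetric interp_adj.
Proof. by move=> a b; apply: eta_sym. Qed.

Lemma interp_adj_irr : irreflexive interp_adj.
Proof. by move=> a; exact: (@eta_irr U I G (val a)). Qed.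

Definition interp : graph := Graph interp_adj_sym interp_adj_irr.
End Interpret.

Definition interp_op U (I : interpretation U) : multimap (cgraph U) graph :=
  fun G H => isomorphic (interp I G) H.

Definition transduction_op k U (I : interpretation U) : operation :=
  interp_op I ∘ @coloring_op U ∘ copy_op k.

Definition transduction (T : operation) : Prop :=
  exists k U (I : interpretation U), 0 < k /\ same_op T (transduction_op k I).

Definition non_copying (T : operation) : Prop :=
  exists U (I : interpretation U), same_op T (transduction_op 1 I).

Definition dist_le (G : graph) (r : nat) (x y : G) : bool :=
  [exists n : 'I_r.+1, [exists p : n.-tuple G,
    path (@adj G) x p && (last x p == y)]].

Definition ball (G : graph) (r : nat) (A : {set G}) : {set G} :=
  [set y | [exists x in A, dist_le r x y]].

Section Induced.
Variables (U : Type) (G : cgraph U) (A : {set G}).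

Definition induced_vertex : finType := {x : G | x \in A}.

Definition induced_adj : rel induced_vertex := fun a b => adj (val a) (val b).

Lemma induced_adj_sym : symmetric induced_adj.
Proof. by move=> a b; apply: adj_sym. Qed.

Lemma induced_adj_irr : irreflexive induced_adj.
Proof. by move=> a; apply: adj_irr. Qed.

Definition induced : cgraph U :=
  @CGraph U (Graph induced_adj_sym induced_adj_irr)
    (fun u => [set a | val a \in color G u]).
End Induced.

Section Locality.
Variables (U : Type) (n : nat) (r : nat) (f : formula U n).

Definition env_set (G : cgraph U) (v : 'I_n -> G) : {set G} :=
  [set v i | i : 'I_n].

Lemma env_in_ball (G : cgraph U) (v : 'I_n -> G) i :
  v i \in ball r (env_set v).
Proof.
rewrite inE; apply/existsP; exists (v i).
rewrite imset_f //=; apply/existsP; exists ord0.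
by apply/existsP; exists [tuple]; rewrite /= eqxx.
Qed.

Definition ball_env (G : cgraph U) (v : 'I_n -> G) :
    'I_n -> induced (ball r (env_set v)) :=
  fun i => Sub (v i) (env_in_ball v i).

Definition local_formula : Prop :=
  forall (G : cgraph U) (v : 'I_n -> G), sat f v = sat f (ball_env v).

Definition strongly_local_at : Prop :=
  local_formula /\
  forall (G : cgraph U) (v : 'I_n -> G), sat f v ->
    forall i j : 'I_n, i < j -> dist_le r (v i) (v j).
End Locality.

Definition strongly_local U n (f : formula U n) : Prop :=
  exists r, strongly_local_at r f.

Definition immersive (T : operation) : Prop :=
  exists U (I : interpretation U),
    [/\ strongly_local (nu I), strongly_local (eta I)
      & same_op T (transduction_op 1 I)].

(** The single color [tt : unit] is the complemented set M. *)
Definition compl_nu : formula unit 1 := FTrue.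
Definition compl_eta : formula unit 2 :=
  FAnd (FNot (FEq ord0 ord_max))
       (FNot (FIff (FAdj ord0 ord_max)
                    (FAnd (FCol tt ord0) (FCol tt ord_max)))).

Lemma sat_compl_eta (G : cgraph unit) (a b : G) :
  sat compl_eta (env2 a b) =
  (a != b) && (adj a b != ((a \in color G tt) && (b \in color G tt))).
Proof.
have max1 : ord_max = lift ord0 ord0 :> 'I_2 by apply: val_inj.
rewrite /= max1 /env2 /env_cons liftK unlift_none /env1.
by case: adj; case: (a \in _); case: (b \in _).
Qed.

Lemma compl_eta_sym (G : cgraph unit) :
  symmetric (fun a b : G => sat compl_eta (env2 a b)).
Proof.
move=> a b; rewrite !sat_compl_eta (eq_sym a) (adj_sym a).
by rewrite (andbC (a \in _)).
Qed.

Lemma compl_eta_irr (G : cgraph unit) :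
  irreflexive (fun a b : G => sat compl_eta (env2 a b)).
Proof. by move=> a; rewrite sat_compl_eta eqxx. Qed.

Definition compl_interp : interpretation unit :=
  @Interpretation unit compl_nu compl_eta compl_eta_sym compl_eta_irr.

Definition subset_complementation : operation := transduction_op 1 compl_interp.

Fixpoint iter_complementation (n : nat) : operation :=
  if n is m.+1 then subset_complementation ∘ iter_complementation m
  else isomorphic.

Definition perturbation (P : operation) : Prop :=
  exists n, same_op P (iter_complementation n).

(* Main.v *)
(** Inside one fixed graph, the truth of a first-order formula on a tuple is
    determined by a bounded local back-and-forth game around that tuple: this is
    Gaifman's theorem without its sentences, which are constant on a given
    graph. Hence, for vertices far apart, eta(x,y) is a symmetric relation R between
    the local types of x and of y, and xoring eta with R leaves a relation that
    only holds at bounded distance and is determined by the local type of (x,y).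
    The immersive transduction defines this remainder by guessing, as colors,
    the set nu and which pair types are adjacent. There are boundedly many
    types, so xoring with R again takes boundedly many subset complementations.
    R and the guessed colors depend on the graph; their number does not. *)
Require Import Defs.
From mathcomp Require Import all_boot.
From mathcomp Require Import zify.

Set Implicit Arguments.
Unset Strict Implicit.
Unset Printing Implicit Defensive.

(** * Bounded distance in a graph *)

Section Distance.
Variable G : graph.
Implicit Types (x y z : G) (d e : nat).

(** The recursion on the radius is the one that the distance formula [FDist] follows; [dst_dist_le]
    leads back to [dist_le]. *)
Fixpoint dst d x y : bool :=
  (x == y) || (if d is d'.+1 then [exists z, adj x z && dst d' z y] else false).

Lemma dstxx d x : dst d x x.
Proof. by case: d => [|d] /=; rewrite eqxx. Qed.

Lemma dst_mono d e x y : d <= e -> dst d x y -> dst e x y.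
Proof.
elim: d e x => [|d IH] [|e] // x de.
  by rewrite [dst 0 _ _]/= orbF => /eqP->; apply: dstxx.
move=> /= /orP[->//|/existsP[z /andP[xz zy]]].
by apply/orP; right; apply/existsP; exists z; rewrite xz (IH e).
Qed.

Lemma dst_trans d e x y z : dst d x y -> dst e y z -> dst (d + e) x z.
Proof.
elim: d x => [|d IH] x; first by rewrite [dst 0 _ _]/= orbF => /eqP->.
case/orP=> [/eqP->|/existsP[w /andP[xw wy]] yz]; first exact/dst_mono/leq_addl.
by rewrite addSn /=; apply/orP; right; apply/existsP; exists w; rewrite xw IH.
Qed.

Lemma dst_sym d x y : dst d x y = dst d y x.
Proof.
suff sub u w : dst d u w -> dst d w u by apply/idP/idP; apply: sub.
elim: d u w => [|d IH] u w /=; first by rewrite !orbF eq_sym.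
case/orP=> [/eqP->|/existsP[z /andP[uz zw]]]; first by rewrite eqxx.
rewrite -[_ || _]/(dst d.+1 w u) -addn1; apply: dst_trans (IH _ _ zw) _ => /=.
by apply/orP; right; apply/existsP; exists u; rewrite adj_sym uz eqxx.
Qed.

Lemma dst1 x y : dst 1 x y = (x == y) || adj x y.
Proof.
rewrite /=; congr orb; apply/existsP/idP => [[z /andP[xz]]|xy].
  by rewrite orbF => /eqP<-.
by exists y; rewrite xy eqxx.
Qed.

Lemma dst_dist_le d x y : dst d x y -> dist_le d x y.
Proof.
move=> xy; suff [p [sp xp lp]] :
    exists p : seq G, [/\ size p <= d, path (@adj G) x p & last x p = y].
  apply/existsP; exists (Ordinal (sp : size p < d.+1)).
  by apply/existsP; exists (in_tuple p); rewrite xp /= lp eqxx.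
elim: d x xy => [|d IH] x /=; first by rewrite orbF => /eqP<-; exists [::].
case/orP=> [/eqP<-|/existsP[z /andP[xz zy]]]; first by exists [::].
by have [p [sp zp lp]] := IH _ zy; exists (z :: p); rewrite /= xz.
Qed.

End Distance.

(** * Local back-and-forth games inside one graph *)

Section LocalGame.
Variable G : graph.
Implicit Types (s t : seq (G * G)) (P : seq {set G}) (D k : nat).

Definition swap s := [seq (p.2, p.1) | p <- s].

(** A partial isomorphism for the sets in [P], refined by distances truncated at [D]: distance 0
    gives equality, and distance 1, once [D] is positive, gives adjacency. *)
Definition compat P D s : bool :=
  all (fun p => all (fun A : {set G} => (p.1 \in A) == (p.2 \in A)) P &&
    all (fun q => [forall d : 'I_D.+1, dst d p.1 q.1 == dst d p.2 q.2]) s) s.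

Definition forth (X : seq (G * G) -> bool) D s : bool :=
  [forall a, has (fun p => dst D p.1 a) s ==> [exists b, X ((a, b) :: s)]].

(* A position [s] lists the pebbled pairs, both sides in the same graph [G];
   each of the [k] remaining moves stays within distance [D] of the pebbles. *)
Fixpoint game P D k s : bool :=
  compat P D s && (if k is k'.+1 then
    forth (game P D k') D s && forth (fun t => game P D k' (swap t)) D (swap s)
    else true).

Lemma swapK s : swap (swap s) = s.
Proof. by rewrite /swap -map_comp map_id_in // => -[]. Qed.

Lemma mem_swap s p : (p \in swap s) = ((p.2, p.1) \in s).
Proof.
case: p => a b /=; apply/mapP/idP => [[[c d] cd [-> ->]]//|ba].
by exists (b, a).
Qed.

Lemma compatP P D s : reflect
  ((forall p A, p \in s -> A \in P -> (p.1 \in A) = (p.2 \in A)) /\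
   (forall p q d, p \in s -> q \in s -> d <= D ->
      dst d p.1 q.1 = dst d p.2 q.2)) (compat P D s).
Proof.
apply: (iffP allP) => [H|[H1 H2] p ps].
  split=> [p A ps AP|p q d ps qs dD]; have /andP[/allP H1 /allP H2] := H _ ps.
    exact/eqP/H1.
  exact: (eqP (forallP (H2 _ qs) (Ordinal (dD : d < D.+1)))).
apply/andP; split; apply/allP; first by move=> A AP; rewrite (H1 p A).
by move=> q qs; apply/forallP => d; rewrite (H2 p q d) // -ltnS.
Qed.

Lemma forthP (X : seq (G * G) -> bool) D s : reflect
  (forall a p, p \in s -> dst D p.1 a -> exists b, X ((a, b) :: s))
  (forth X D s).
Proof.
apply: (iffP forallP) => [H a p ps pa|H a].
  by apply/existsP/(implyP (H a)); apply/hasP; exists p.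
by apply/implyP=> /hasP[p ps pa]; apply/existsP/H/pa.
Qed.

Lemma game_compat P D k s : game P D k s -> compat P D s.
Proof. by case: k => [|k] /= /andP[]. Qed.

Lemma compat_swap P D s : compat P D s -> compat P D (swap s).
Proof.
move=> /compatP[H1 H2]; apply/compatP; split=> [p A|p q d]; rewrite !mem_swap.
  by move=> ps AP; rewrite -(H1 (p.2, p.1) A).
by move=> ps qs dD; rewrite (H2 (p.2, p.1) (q.2, q.1)).
Qed.

Lemma eq_forth (X Y : seq (G * G) -> bool) D s :
  X =1 Y -> forth X D s = forth Y D s.
Proof.
by move=> XY; apply: eq_forallb => a; under eq_existsb do rewrite XY.
Qed.

Lemma game_swap P D k s : game P D k (swap s) = game P D k s.
Proof.
suff sub t : game P D k t -> game P D k (swap t).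
  by apply/idP/idP => [/sub|/sub//]; rewrite swapK.
elim: k t => [|k IH] t /= /andP[ct]; first by rewrite (compat_swap ct).
case/andP=> f1 f2; rewrite compat_swap //= swapK; apply/andP; split.
  apply/forthP => a p pt pa; have /forthP/(_ a p pt pa)[b /IH] := f2.
  by rewrite swapK; exists b.
by apply/forthP => a p pt pa; have /forthP/(_ a p pt pa)[b /IH] := f1; exists b.
Qed.

(** Invariance under exchanging the sides removes the inner [swap], so that forward and backward
    moves are both instances of [forth] and share one argument. *)
Lemma gameS P D k s : game P D k.+1 s =
  [&& compat P D s, forth (game P D k) D s & forth (game P D k) D (swap s)].
Proof.
by rewrite /= (eq_forth _ _ (fun t => game_swap P D k t)).
Qed.

Lemma compat_mono P P' D D' s s' : {subset P <= P'} -> D <= D' ->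
  {subset s <= s'} -> compat P' D' s' -> compat P D s.
Proof.
move=> PP' DD' ss' /compatP[H1 H2]; apply/compatP.
split=> [p A /ss' ps /PP' /H1|p q d /ss' ps /ss' qs dD]; first exact.
by apply: H2 => //; apply: leq_trans DD'.
Qed.

(** A strategy for the harder game is still good for the easier one. In particular a position counts
    only as a set of pairs and may be reordered. *)
Lemma game_mono P P' D D' k k' s s' : {subset P <= P'} -> D <= D' -> k <= k' ->
  {subset s <= s'} -> game P' D' k' s' -> game P D k s.
Proof.
move=> PP' DD'; elim: k k' s s' => [|k IH] k' s s' kk' ss' gs'.
  by rewrite /= andbT; apply: compat_mono (game_compat gs').
case: k' kk' gs' => // k' kk'.
have fo t t' : {subset t <= t'} -> forth (game P' D' k') D' t' ->
    forth (game P D k) D t.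
  move=> tt' /forthP f; apply/forthP => a p /tt' pt /(dst_mono DD') pa.
  have [b gb] := f a p pt pa; exists b; apply: IH gb => // q.
  by rewrite !inE => /orP[->//|/tt' ->]; rewrite orbT.
rewrite !gameS => /and3P[cs' f1 f2]; apply/and3P; split.
- exact: compat_mono cs'.
- exact: fo f1.
- by apply: fo f2 => p; rewrite !mem_swap => /ss'.
Qed.

Lemma game_refl P D k (S : seq G) : game P D k [seq (x, x) | x <- S].
Proof.
have cp T : compat P D [seq (x, x) | x <- T].
  by apply/compatP; split=> [_ A|_ _ d] /mapP[x _ ->] // /mapP[y _ ->].
elim: k S => [|k IH] S; first by rewrite /= cp.
have swapS : swap [seq (x, x) | x <- S] = [seq (x, x) | x <- S].
  by rewrite /swap -map_comp.
rewrite gameS cp swapS andbb.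
by apply/forthP => a p _ _; exists a; apply: (IH (a :: S)).
Qed.

(** Strategies compose: the answer in the first game is the challenge in the second. The triples
    keep the shared middle pebbles aligned, and the reversed triples handle backward moves. *)
Lemma game_trans P D k (w : seq (G * G * G)) :
  game P D k [seq p.1 | p <- w] -> game P D k [seq (p.1.2, p.2) | p <- w] ->
  game P D k [seq (p.1.1, p.2) | p <- w].
Proof.
have cp v : compat P D [seq p.1 | p <- v] ->
    compat P D [seq (p.1.2, p.2) | p <- v] ->
    compat P D [seq (p.1.1, p.2) | p <- v].
  move=> /compatP[H1 H2] /compatP[K1 K2]; apply/compatP.
  split=> [_ A /mapP[p pv ->] AP|_ _ d /mapP[p pv ->] /mapP[q qv ->] dD] /=.
    rewrite (H1 p.1) ?map_f //; apply: (K1 (p.1.2, p.2)) => //.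
    exact: (map_f (fun p => (p.1.2, p.2))).
  rewrite (H2 p.1 q.1) ?map_f //.
  by apply: (K2 (p.1.2, p.2) (q.1.2, q.2)) => //;
     apply: (map_f (fun p => (p.1.2, p.2))).
elim: k w => [|k IH] w; first by rewrite /= !andbT; apply: cp.
have fo v : compat P D [seq p.1 | p <- v] ->
    forth (game P D k) D [seq p.1 | p <- v] ->
    forth (game P D k) D [seq (p.1.2, p.2) | p <- v] ->
    forth (game P D k) D [seq (p.1.1, p.2) | p <- v].
  move=> c1 /forthP f1 /forthP f2; apply/forthP => a _ /mapP[p pv ->] /= pa.
  have [b gb] := f1 a p.1 (map_f _ pv) pa.
  (* Truncated distances are preserved, so [b] is as close to its pebble as [a] was, which makes [b]
     a legal move in the second game. *)
  have /compatP[_ /(_ p.1 (a, b) D)] := game_compat gb.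
  rewrite !inE map_f // eqxx !orbT pa => /(_ isT isT (leqnn _)) /esym pb.
  have [c gc] := f2 b _ (map_f (fun p => (p.1.2, p.2)) pv) pb.
  by exists c; apply: (IH ((a, b, c) :: v)).
rewrite !gameS => /and3P[c1 f1 b1] /and3P[c2 f2 b2].
rewrite cp // fo //=.
have := fo [seq (p.2, p.1.2, p.1.1) | p <- w].
rewrite /swap -!map_comp /=; apply.
- by move: (compat_swap c2); rewrite /swap -map_comp.
- by move: b2; rewrite /swap -map_comp.
- by move: b1; rewrite /swap -map_comp.
Qed.

Definition apart d s t := forall p q, p \in s -> q \in t ->
  ~~ dst d p.1 q.1 && ~~ dst d p.2 q.2.

(** The two games are played independently. Each move brings the groups closer by at most [D], so
    after [k] moves they are still more than [D] apart on both sides, where [compat] sees no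
    difference. *)
Lemma game_cat P D k s t : apart (D * k.+1) s t ->
  game P D k s -> game P D k t -> game P D k (s ++ t).
Proof.
have cp d u v : D <= d -> apart d u v -> compat P D u -> compat P D v ->
    compat P D (u ++ v).
  move=> Dd uv /compatP[H1 H2] /compatP[K1 K2]; apply/compatP.
  split=> [p A|p q e]; rewrite !mem_cat.
    by case/orP=> [/H1|/K1]; apply.
  move=> pu qu eD.
  case/orP: pu qu => [pu|pu] /orP[qu|qu]; [exact: H2| | |exact: K2].
    have /andP[/negP n1 /negP n2] := uv p q pu qu.
    by apply/idP/idP=> /(dst_mono (leq_trans eD Dd)).
  have /andP[/negP n1 /negP n2] := uv q p qu pu.
  by apply/idP/idP=> /(dst_mono (leq_trans eD Dd)); rewrite dst_sym.
elim: k s t => [|k IH] s t st; first by rewrite /= !andbT; apply: cp st; lia.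
have move1 u v a p : apart (D * k.+2) u v -> p \in u -> dst D p.1 a ->
    game P D k.+1 u -> game P D k.+1 v ->
    exists b, game P D k (((a, b) :: u) ++ v).
  move=> uv pu pa; rewrite gameS => /and3P[_ /forthP f _] gv.
  have [b gb] := f a p pu pa; exists b; apply: IH (gb) _; last first.
    exact: game_mono gv.
  (* The answer [b] lies within [D] of [p.2], so the right-hand separation also shrinks by at most
     [D]. *)
  have /compatP[_ /(_ p (a, b) D)] := game_compat gb.
  rewrite !inE pu eqxx orbT => /(_ isT isT (leqnn _)) /= E.
  move=> q q' /[!inE] /orP[/eqP->|qu] q'v /=.
    have /andP[n1 n2] := uv p q' pu q'v.
    apply/andP; split; [apply: contra n1|apply: contra n2] => aq;
      rewrite mulnS; apply: dst_trans aq => //.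
    by rewrite -E.
  have /andP[n1 n2] := uv q q' qu q'v.
  by apply/andP; split; [apply: contra n1|apply: contra n2];
    apply: dst_mono; rewrite leq_mul2l leqnSn orbT.
have fo u v : apart (D * k.+2) u v -> game P D k.+1 u -> game P D k.+1 v ->
    forth (game P D k) D (u ++ v).
  move=> uv gu gv; apply/forthP => a p; rewrite mem_cat => /orP[pu|pv] pa.
    exact: move1 uv pu pa gu gv.
  have vu : apart (D * k.+2) v u.
    by move=> q q' qv q'u; rewrite !(dst_sym _ q.1) !(dst_sym _ q.2) uv.
  have [b gb] := move1 _ _ _ _ vu pv pa gv gu; exists b.
  by apply: game_mono gb => // q; rewrite !inE !mem_cat (orbC (q \in u)).
move=> gs gt; rewrite gameS fo //.
have -> : compat P D (s ++ t).
  by apply: cp st (game_compat gs) (game_compat gt); lia.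
rewrite /swap map_cat; apply: fo; rewrite ?game_swap //.
move=> p q; rewrite !mem_swap => ps qt.
by rewrite andbC (st (p.2, p.1) (q.2, q.1)).
Qed.

(** The vertices of [S] are played one after the other as backward moves. Each is near an original
    right-hand pebble, hence legal at any time, and costs one round. *)
Lemma game_back P D k s (S : seq G) :
  (forall b, b \in S -> has (fun q => dst D q.2 b) s) ->
  game P D (size S + k) s ->
  exists2 t, [seq p.2 | p <- t] = S & game P D k (t ++ s).
Proof.
elim: S s => [|b S IH] s near; first by exists [::].
rewrite addSn gameS => /and3P[_ _ /forthP f].
have /hasP[q qs qb] := near b (mem_head _ _).
have [|a ga] := f b (q.2, q.1) _ qb; first by rewrite mem_swap; case: (q) qs.
rewrite -[_ :: _]/(swap ((a, b) :: s)) game_swap in ga.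
have [|t tS gt] := IH _ _ ga.
  by move=> c cS; apply/orP; right; apply: near; rewrite inE cS orbT.
exists ((a, b) :: t); rewrite /= ?tS //.
by apply: game_mono gt => // p; rewrite !inE !mem_cat inE orbCA.
Qed.

(** Pigeonhole: two members of [S] sent to the same vertex of [s] would be within [d + d] of each
    other. *)
Lemma scattered_size d (s S : seq G) :
  pairwise (fun x y => ~~ dst (d + d) x y) S ->
  (forall b, b \in S -> has (fun q => dst d q b) s) -> size S <= size s.
Proof.
move=> sc near; pose f b := find (fun q => dst d q b) s.
have x0 b (bS : b \in S) : dst d (nth b s (f b)) b.
  by have /= := nth_find b (near b bS).
rewrite -(size_map f) -(size_iota 0 (size s)); apply: uniq_leq_size; last first.
  by move=> _ /mapP[b /near hb ->]; rewrite mem_iota /= -has_find.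
elim: S sc near x0 => //= b S IH /andP[/allP bS sc] near x0.
rewrite IH ?andbT //; last 2 first.
- by move=> c cS; apply: near; rewrite inE cS orbT.
- by move=> c cS; apply: x0; rewrite inE cS orbT.
apply/mapP => -[c cS fbc]; have /negP[] := bS c cS.
apply: (@dst_trans _ _ _ _ (nth b s (f b))).
  by rewrite dst_sym x0 ?mem_head.
rewrite fbc (set_nth_default c) ?x0 ?inE ?cS ?orbT //.
by rewrite -has_find near // inE cS orbT.
Qed.

(* If every [b] equivalent to [a] were close to the right-hand pebbles, then any
   scattered set of such [b] could be pulled back next to the left-hand pebbles,
   and [a], far from these, would enlarge it: beyond size [n], two members of the
   set would lie near the same pebble. *)
Lemma game_extend P D k n s a : size s <= n ->
  game P (3 * (D * k.+1)) (n + k.+1) s ->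
  exists b, game P D k ((a, b) :: s).
Proof.
(* The radius [3 * r] is the separation [2 * r] of a scattered set plus the distance [r] from its
   members to a pebble. The [n] additional rounds pay for pulling back at most [n] vertices. *)
set r := D * k.+1 => sn gs; have Dr : D <= 3 * r by rewrite /r; nia.
have [/hasP[p ps pa]|far] := boolP (has (fun p => dst (3 * r) p.1 a) s).
  move: gs; rewrite addnS gameS => /and3P[_ /forthP/(_ a p ps pa)[b gb] _].
  by exists b; apply: game_mono gb => //; lia.
have nfar p : p \in s -> dst (3 * r) a p.1 = false.
  move=> ps; apply: contraNF far => ap.
  by apply/hasP; exists p; rewrite // dst_sym.
pose good b := game P D k [:: (a, b)].
have [/existsP[b /andP[gb /allP fb]]|near] :=
    boolP [exists b, good b && all (fun q => ~~ dst r q.2 b) s].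
  exists b; apply: (@game_cat _ _ _ [:: (a, b)]) => //; last first.
    by apply: game_mono gs => //; lia.
  move=> p q /[!inE] /eqP-> qs /=; rewrite (dst_sym _ b) fb // andbT.
  by apply: contraFN (nfar q qs); apply: dst_mono; lia.
have {}near b : good b -> has (fun q => dst r q.2 b) s.
  move=> gb; move: near; rewrite negb_exists => /forallP/(_ b).
  rewrite gb /= -has_predC; apply: sub_has => q; exact: negbNE.
suff [S [szS gS scS]] : exists S, [/\ size S = n.+1, all good S &
    pairwise (fun x y => ~~ dst (r + r) x y) S].
  have : size S <= size [seq q.2 | q <- s].
    apply: scattered_size scS _ => b /(allP gS) /near.
    by rewrite has_map.
  by rewrite szS size_map; lia.
have : n.+1 <= n.+1 by [].
elim: {-2}n.+1 => [|m IH] mn; first by exists [::].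
have [|S [szS gS scS]] := IH; first lia.
have [||t tS gt] := @game_back P (3 * r) (n - m + k.+1) s S.
- move=> b /(allP gS) /near; apply: sub_has => q; apply: dst_mono; lia.
- by rewrite szS addnA subnKC.
have /compatP[_ ct] := game_compat gt.
exists (a :: [seq p.1 | p <- t]); split.
- by rewrite /= size_map -(size_map snd) tS szS.
- rewrite /= {1}/good (game_refl P D k [:: a]) /=.
  apply/allP => _ /mapP[[c b] cbt ->] /=.
  (* The vertex [c] was pulled back from [b], and [b] is equivalent to [a]; composing the first game
     with the reversed second one shows that [c] is good too. *)
  apply: (@game_trans _ _ _ [:: (a, b, c)]) => /=.
    by apply/(allP gS); rewrite -tS (map_f snd cbt).
  rewrite -game_swap; apply: game_mono gt => //; try lia.
  by move=> p /[!inE] /eqP->; rewrite mem_cat cbt.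
rewrite /= ; apply/andP; split.
  apply/allP => _ /mapP[[c b] cbt ->] /=.
  have /near/hasP[q qs qb] : good b.
    by apply/(allP gS); rewrite -tS (map_f snd cbt).
  have qc : dst r q.1 c.
    by rewrite (ct q (c, b)) ?mem_cat ?qs ?cbt ?orbT //; lia.
  apply: contraFN (nfar q qs) => ac.
  rewrite (_ : 3 * r = (r + r) + r); last lia.
  by apply: dst_trans ac _; rewrite dst_sym.
move: scS; rewrite -tS !pairwise_map; apply: sub_in_pairwise (allss t).
move=> p q /= pt qt; apply: contra.
by rewrite (ct p q) ?mem_cat ?pt ?qt //; lia.
Qed.

End LocalGame.

(** * Formulas are decided by local games *)

Section Formulas.
Variable U : Type.

Definition colors (G : cgraph U) (cs : seq U) := [seq color G u | u <- cs].

Definition pairs (G : graph) n (v w : 'I_n -> G) := codom (fun i => (v i, w i)).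

Lemma mem_pairs (G : graph) n (v w : 'I_n -> G) i : (v i, w i) \in pairs v w.
Proof. exact: (codom_f (fun i => (v i, w i))). Qed.

Lemma swap_pairs (G : graph) n (v w : 'I_n -> G) : swap (pairs v w) = pairs w v.
Proof. by rewrite /swap /pairs /codom /image_mem -map_comp. Qed.

Lemma env_cons0 (V : Type) n (x : V) (v : 'I_n -> V) : env_cons x v ord0 = x.
Proof. by rewrite /env_cons unlift_none. Qed.

Lemma env_consS (V : Type) n (x : V) (v : 'I_n -> V) i :
  env_cons x v (lift ord0 i) = v i.
Proof. by rewrite /env_cons liftK. Qed.

Lemma eq_env_cons (V : Type) n (x : V) (v : 'I_n -> V) w :
  w ord0 = x -> (forall i, w (lift ord0 i) = v i) -> env_cons x v =1 w.
Proof.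
by move=> w0 wS i; case: (unliftP ord0 i) => [j|] ->;
  rewrite ?env_consS ?env_cons0.
Qed.

Lemma pairs_cons (G : graph) n (v w : 'I_n -> G) a b :
  pairs (env_cons a v) (env_cons b w) =i (a, b) :: pairs v w.
Proof.
move=> p; rewrite inE; apply/codomP/orP => [[i ->]|[/eqP->|/codomP[i ->]]].
- case: (unliftP ord0 i) => [j|] ->; rewrite ?env_consS ?env_cons0 ?eqxx.
    by right; apply: mem_pairs.
  by left.
- by exists ord0; rewrite !env_cons0.
- by exists (lift ord0 i); rewrite !env_consS.
Qed.

Lemma eq_sat (G : cgraph U) n (f : formula U n) (v w : 'I_n -> G) :
  v =1 w -> sat f v = sat f w.
Proof.
elim: f v w => {n} [n|n i j|n i j|n u i|n f IH|n f IHf g IHg|n f IH] v w vw //=.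
- by rewrite !vw.
- by rewrite !vw.
- by rewrite !vw.
- by rewrite (IH v w).
- by rewrite (IHf v w) // (IHg v w).
- apply: eq_existsb => x; apply: IH; apply: eq_env_cons => [|i].
    by rewrite env_cons0.
  by rewrite env_consS vw.
Qed.

(** The parameters are fixed by the formula before any graph is given. By induction on it; only the
    quantifier is delicate, as its witness may lie far from all pebbles while moves are local. *)
Lemma sat_game n (f : formula U n) : exists (cs : seq U) D k,
  forall (G : cgraph U) (v w : 'I_n -> G),
    game (colors G cs) D k (pairs v w) -> sat f v = sat f w.
Proof.
elim: f => {n} [n|n i j|n i j|n u i|n f IH|n f IHf g IHg|n f IH].
- by exists [::], 0, 0.
- exists [::], 0, 0 => G v w /game_compat/compatP[_ /(_ _ _ 0)H].
  have := H _ _ (mem_pairs v w i) (mem_pairs v w j) isT.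
  by rewrite /= !orbF.
(* Adjacency means distance at most 1 but not 0, since graphs are loopless. *)
- exists [::], 1, 0 => G v w /game_compat/compatP[_ H].
  have H' d dD := H _ _ d (mem_pairs v w i) (mem_pairs v w j) dD.
  have := H' 1 isT; have := H' 0 isT; rewrite !dst1 /= !orbF.
  have [<-|_] := eqVneq (v i) (v j); last by move=> <-.
  by move=> /esym/eqP <-; rewrite !adj_irr.
- exists [:: u], 0, 0 => G v w /game_compat/compatP[H _] /=.
  by apply: (H _ _ (mem_pairs v w i)); rewrite inE.
- by have [cs [D [k H]]] := IH; exists cs, D, k => G v w /= /H ->.
- have [cs [D [k H]]] := IHf; have [cs' [D' [k' H']]] := IHg.
  exists (cs ++ cs'), (maxn D D'), (maxn k k') => G v w vw /=.
  rewrite (H G v w) ?(H' G v w) //; apply: game_mono vw => //;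
    rewrite ?leq_maxr ?leq_maxl //.
    by move=> A; rewrite /colors map_cat mem_cat => ->; rewrite orbT.
  by move=> A; rewrite /colors map_cat mem_cat => ->.
(* These are the parameters of [game_extend], with [n] bounding the number of pebbles. *)
- have [cs [D [k H]]] := IH; exists cs, (3 * (D * k.+1)), (n + k.+1).
  suff sub (G : cgraph U) (v w : 'I_n -> G) :
      game (colors G cs) (3 * (D * k.+1)) (n + k.+1) (pairs v w) ->
      sat (FExists f) v -> sat (FExists f) w.
    move=> G v w vw; apply/idP/idP; apply: sub => //.
    by rewrite -swap_pairs game_swap.
  move=> vw /existsP[a fa]; have sz : size (pairs v w) <= n.
    by rewrite size_codom card_ord.
  have [b gb] := game_extend a sz vw; apply/existsP; exists b.
  suff fab : sat f (env_cons a v) = sat f (env_cons b w).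
    by have : sat f (env_cons a v) := fa; rewrite fab.
  apply: H.
  by apply: game_mono gb => // p; rewrite pairs_cons.
Qed.

(** * Finite connectives, distance formulas and types *)

Definition FOr n (f g : formula U n) := FNot (FAnd (FNot f) (FNot g)).

Definition FAll n (T : finType) (F : T -> formula U n) :=
  foldr (fun t f => FAnd (F t) f) FTrue (enum T).

Definition FSome n (T : finType) (F : T -> formula U n) :=
  FNot (FAll (fun t => FNot (F t))).

Lemma sat_and (G : cgraph U) n (f g : formula U n) (v : 'I_n -> G) :
  sat (FAnd f g) v = sat f v && sat g v.
Proof. by []. Qed.

Lemma sat_or (G : cgraph U) n (f g : formula U n) (v : 'I_n -> G) :
  sat (FOr f g) v = sat f v || sat g v.
Proof. by rewrite /= negb_and !negbK. Qed.

Lemma sat_all (G : cgraph U) n (T : finType) (F : T -> formula U n)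
  (v : 'I_n -> G) : sat (FAll F) v = [forall t, sat (F t) v].
Proof.
transitivity (all (fun t => sat (F t) v) (enum T)).
  by rewrite /FAll; elim: (enum T) => //= t s ->.
apply/allP/forallP => [H t|H t _]; last exact: H.
by apply: H; rewrite mem_enum.
Qed.

Lemma sat_some (G : cgraph U) n (T : finType) (F : T -> formula U n)
  (v : 'I_n -> G) : sat (FSome F) v = [exists t, sat (F t) v].
Proof.
rewrite -[LHS]/(~~ sat (FAll _) v) sat_all negb_forall.
by apply: eq_existsb => t /=; rewrite negbK.
Qed.

Fixpoint FDist n d (i j : 'I_n) : formula U n :=
  if d is d'.+1 then
    FOr (FEq i j)
        (FExists (FAnd (FAdj (lift ord0 i) ord0) (FDist d' ord0 (lift ord0 j))))
  else FEq i j.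

Lemma sat_dist (G : cgraph U) n d (i j : 'I_n) (v : 'I_n -> G) :
  sat (FDist d i j) v = dst d (v i) (v j).
Proof.
elim: d n i j v => [|d IH] n i j v; first by rewrite /= orbF.
rewrite [FDist _ _ _]/= sat_or /=; congr orb; apply: eq_existsb => x.
by rewrite IH env_cons0 !env_consS.
Qed.

Definition FNear d n : formula U n.+1 :=
  FSome (fun i : 'I_n => FDist d (lift ord0 i) ord0).

Lemma sat_near (G : cgraph U) d n (v : 'I_n -> G) x :
  sat (FNear d n) (env_cons x v) = [exists i, dst d (v i) x].
Proof.
rewrite sat_some; apply: eq_existsb => i.
by rewrite sat_dist env_cons0 env_consS.
Qed.

Lemma sat_exists_near (G : cgraph U) d n (f : formula U n.+1) (v : 'I_n -> G) :
  sat (FExists (FAnd (FNear d n) f)) v =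
  [exists x, [exists i, dst d (v i) x] && sat f (env_cons x v)].
Proof. by apply: eq_existsb => x; rewrite -sat_near. Qed.

(** Types are truth assignments to a finite family of formulas, so they range over a finite type
    that is the same for all graphs. *)
Definition sat_type n (T : finType) (F : T -> formula U n) (G : cgraph U)
  (v : 'I_n -> G) : {ffun T -> bool} := [ffun t => sat (F t) v].

Definition FType n (T : finType) (F : T -> formula U n)
    (b : {ffun T -> bool}) :=
  FAll (fun t => if b t then F t else FNot (F t)).

Lemma sat_FType n (T : finType) (F : T -> formula U n) b (G : cgraph U)
  (v : 'I_n -> G) : sat (FType F b) v = (sat_type F v == b).
Proof.
rewrite sat_all; apply/forallP/eqP => [H|<- t].
  apply/ffunP => t; rewrite ffunE; move: (H t); case: (b t) => //= /negPf //.
by rewrite ffunE; case: ifP => //= ->.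
Qed.

(** * Local formulas and the definability of the local game *)

Definition embedding (G H : cgraph U) (h : H -> G) :=
  [/\ injective h, {mono h : x y / adj x y}
    & forall u x, (h x \in color G u) = (x \in color H u)].

(* Implies [local_formula r f], but compares with all substructures that contain
   the ball, so that it passes through quantifiers without nested balls. *)
Definition local r n (f : formula U n) :=
  forall (G H : cgraph U) (h : H -> G) (w : 'I_n -> H), embedding h ->
    (forall i y, dst r (h (w i)) y -> exists x, h x = y) ->
    sat f (h \o w) = sat f w.

Lemma local_mono r r' n (f : formula U n) : r <= r' -> local r f -> local r' f.
Proof.
move=> rr' lf G H h w emb im; apply: lf => // i y iy.
exact/im/(dst_mono rr' iy).
Qed.

Lemma local_ball r n (f : formula U n) : local r f -> local_formula r f.
Proof.
move=> lf G v; have := lf G (induced (ball r (env_set v))) val (ball_env r v).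
move=> <- //; first by split=> [|//|u x]; [apply: val_inj|rewrite !inE].
move=> i y iy; suff yb : y \in ball r (env_set v) by exists (Sub y yb).
rewrite inE; apply/existsP; exists (v i); rewrite imset_f //=.
exact: dst_dist_le.
Qed.

Lemma local_eq r n (i j : 'I_n) : local r (@FEq U n i j).
Proof. by move=> G H h w [hI _ _] _ /=; rewrite (inj_eq hI). Qed.

Lemma local_col r n u (i : 'I_n) : local r (@FCol U n u i).
Proof. by move=> G H h w [_ _ hc] _ /=; rewrite hc. Qed.

Lemma local_not r n (f : formula U n) : local r f -> local r (FNot f).
Proof. by move=> lf G H h w emb im /=; rewrite -(lf G H h). Qed.

Lemma local_and r n (f g : formula U n) :
  local r f -> local r g -> local r (FAnd f g).
Proof.
by move=> lf lg G H h w emb im; rewrite !sat_and (lf G H h) // (lg G H h).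
Qed.

Lemma local_or r n (f g : formula U n) :
  local r f -> local r g -> local r (FOr f g).
Proof. by move=> lf lg; apply/local_not/local_and; apply: local_not. Qed.

Lemma local_all r n (T : finType) (F : T -> formula U n) :
  (forall t, local r (F t)) -> local r (FAll F).
Proof.
by move=> lF; rewrite /FAll; elim: (enum T) => //= t s; apply: local_and.
Qed.

Lemma local_some r n (T : finType) (F : T -> formula U n) :
  (forall t, local r (F t)) -> local r (FSome F).
Proof. by move=> lF; apply/local_not/local_all => t; apply: local_not. Qed.

Lemma local_type r n (T : finType) (F : T -> formula U n) b :
  (forall t, local r (F t)) -> local r (FType F b).
Proof.
by move=> lF; apply: local_all => t; case: (b t) => //; apply: local_not.
Qed.

(** A path of length at most [d] from [h x] never leaves the image of [h], so it can be pulled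
    back. *)
Lemma embedding_dst (G H : cgraph U) (h : H -> G) d x y : embedding h ->
  (forall z, dst d (h x) z -> exists x', h x' = z) ->
  dst d (h x) (h y) = dst d x y.
Proof.
case=> hI ha _; elim: d x => [|d IH] x im /=; first by rewrite (inj_eq hI).
rewrite (inj_eq hI); congr orb; apply/existsP/existsP => -[z /andP[xz zy]].
  have [|z' z'z] := im z.
    by apply: (@dst_mono _ 1); rewrite // dst1 xz orbT.
  exists z'; rewrite -ha z'z xz -IH ?z'z // => u zu.
  by apply: im; rewrite -[d.+1]add1n (dst_trans _ zu) // dst1 xz orbT.
exists (h z); rewrite ha xz IH // => u zu.
by apply: im; rewrite -[d.+1]add1n (dst_trans _ zu) // dst1 ha xz orbT.
Qed.

Lemma local_dist r d n (i j : 'I_n) : d <= r -> local r (FDist d i j).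
Proof.
move=> dr G H h w emb im; rewrite !sat_dist /= embedding_dst // => z wz.
exact/(im i)/(dst_mono dr wz).
Qed.

(** The witness is within [d] of the tuple, so the ball of radius [r] around it lies in the ball of
    radius [d + r] around the tuple. *)
Lemma local_exists r d n (f : formula U n.+1) : local r f ->
  local (d + r) (FExists (FAnd (FNear d n) f)).
Proof.
move=> lf G H h w emb im.
have ev x : h \o env_cons x w =1 env_cons (h x) (h \o w).
  by apply: fsym; apply: eq_env_cons => [|i] /=; rewrite ?env_cons0 ?env_consS.
have step x : [exists i, dst d (w i) x] ->
    sat f (env_cons (h x) (h \o w)) = sat f (env_cons x w).
  case/existsP=> i ix; rewrite -(eq_sat _ (ev x)); apply: lf => // j y.
  case: (unliftP ord0 j) => [j'|] ->; rewrite ?env_consS ?env_cons0 => jy.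
    exact/(im j')/(dst_mono _ jy)/leq_addl.
  apply: (im i); apply: dst_trans jy; rewrite embedding_dst // => z iz.
  exact/(im i)/(dst_mono _ iz)/leq_addr.
have near x : [exists i, dst d (h (w i)) (h x)] = [exists i, dst d (w i) x].
  apply: eq_existsb => i; rewrite embedding_dst // => z iz.
  exact/(im i)/(dst_mono _ iz)/leq_addr.
rewrite !sat_exists_near; apply/existsP/existsP => -[x /andP[nx fx]].
  have /existsP[i ix] := nx; have [|x' x'x] := im i x.
    exact/(dst_mono _ ix)/leq_addr.
  by exists x'; rewrite -near x'x nx -step ?x'x // -near x'x.
by exists (h x); rewrite near nx step.
Qed.

(** Local Hintikka formulas: by induction on [k], the type of a tuple records its colors and
    truncated distances, together with the types for [k - 1] moves of its extensions by one vertex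
    within [D]. *)
Lemma game_local (cs : seq U) D k n : exists (T : finType)
    (F : T -> formula U n) r, (forall t, local r (F t)) /\
  forall (G : cgraph U) (v w : 'I_n -> G), sat_type F v = sat_type F w ->
    game (colors G cs) D k (pairs v w).
Proof.
pose T0 n : finType := ('I_(size cs) * 'I_n + 'I_D.+1 * ('I_n * 'I_n))%type.
pose F0 n (t : T0 n) : formula U n :=
  match t with
  | inl (c, i) => FCol (tnth (in_tuple cs) c) i
  | inr (d, (i, j)) => FDist d i j
  end.
have local0 m t : local D (@F0 m t).
  case: t => [[c i]|[d [i j]]]; first exact: local_col.
  by apply: local_dist; rewrite -ltnS.
have compat0 m (G : cgraph U) (v w : 'I_m -> G) :
    sat_type (@F0 m) v = sat_type (@F0 m) w ->
    compat (colors G cs) D (pairs v w).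
  move=> /ffunP vw; apply/compatP; split=> [p A|p q d].
    case/codomP=> i -> /(nthP set0)[c]; rewrite size_map => cs_c <-.
    have := vw (inl (Ordinal cs_c, i)); rewrite !ffunE /=.
    have u0 := tnth (in_tuple cs) (Ordinal cs_c).
    by rewrite /colors (nth_map u0) // !(tnth_nth u0).
  case/codomP=> i -> /codomP[j ->] dD.
  have := vw (inr (Ordinal (dD : d < D.+1), (i, j))); rewrite !ffunE /=.
  by rewrite !sat_dist.
elim: k n => [|k IH] n.
  exists (T0 n), (@F0 n), D; split=> // G v w /compat0 /= ->//.
have [T [F [r [lF gF]]]] := IH n.+1.
pose E b := FExists (FAnd (FNear D n) (FType F b)).
exists (T0 n + {ffun T -> bool})%type,
  (fun t => match t with inl t => @F0 n t | inr b => E b end), (D + r).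
split=> [[t|b]|G v w /ffunP vw].
- exact: local_mono (leq_addr _ _) (local0 _ _).
- by apply: local_exists; apply: local_type.
have vw0 : sat_type (@F0 n) v = sat_type (@F0 n) w.
  by apply/ffunP => t; have := vw (inl t); rewrite !ffunE.
have fo (v' w' : 'I_n -> G) : (forall b, sat (E b) v' = sat (E b) w') ->
    forth (game (colors G cs) D k) D (pairs v' w').
  move=> vw'; apply/forthP => a _ /codomP[i ->] ia.
  have : sat (E (sat_type F (env_cons a v'))) v'.
    rewrite sat_exists_near; apply/existsP; exists a.
    by rewrite sat_FType eqxx andbT; apply/existsP; exists i.
  rewrite vw' sat_exists_near => /existsP[b /andP[_]].
  rewrite sat_FType eq_sym => /eqP/gF gb.
  by exists b; apply: game_mono gb => // p; rewrite pairs_cons.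
have vwE b : sat (E b) v = sat (E b) w by have := vw (inr b); rewrite !ffunE.
by rewrite gameS compat0 // swap_pairs !fo.
Qed.

End Formulas.

(** * Renaming and symmetrizing formulas *)

Fixpoint remap U U' (g : U -> U') n (f : formula U n) :
    forall m, ('I_n -> 'I_m) -> formula U' m :=
  match f in formula _ n return forall m, ('I_n -> 'I_m) -> formula U' m with
  | FTrue _ => fun m h => FTrue
  | FEq _ i j => fun m h => FEq (h i) (h j)
  | FAdj _ i j => fun m h => FAdj (h i) (h j)
  | FCol _ u i => fun m h => FCol (g u) (h i)
  | FNot _ f => fun m h => FNot (remap g f h)
  | FAnd _ f f' => fun m h => FAnd (remap g f h) (remap g f' h)
  | FExists _ f => fun m h =>
      FExists (remap g f (env_cons ord0 (fun i => lift ord0 (h i))))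
  end.

Definition pullback_colors U U' (g : U -> U') (G : cgraph U') : cgraph U :=
  @CGraph U G (fun u => color G (g u)).

(** Renaming colors moves a formula into the signature with flags; renaming variables exchanges two
    vertices or turns a formula on one vertex into one on pairs. *)
Lemma sat_remap U U' (g : U -> U') n (f : formula U n) m (h : 'I_n -> 'I_m)
    (G : cgraph U') (v : 'I_m -> G) :
  sat (remap g f h) v = @sat U (pullback_colors g G) n f (v \o h).
Proof.
elim: f m h v => {n} //= [n f IH|n f IHf f' IHf'|n f IH] m h v.
- by rewrite IH.
- by rewrite IHf IHf'.
- apply: eq_existsb => x; rewrite IH; apply/eq_sat/fsym/eq_env_cons => [|i] /=.
    by rewrite !env_cons0.
  by rewrite !env_consS.
Qed.

Lemma sat_remap_id U n (f : formula U n) m (h : 'I_n -> 'I_m) (G : cgraph U)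
  (v : 'I_m -> G) : sat (remap id f h) v = sat f (v \o h).
Proof. by rewrite sat_remap; case: G v. Qed.

Lemma local_remap U U' (g : U -> U') r n (f : formula U n) m
    (h : 'I_n -> 'I_m) : local r f -> local r (remap g f h).
Proof.
move=> lf G H e w [eI ea ec] im; rewrite !sat_remap.
apply: (lf (pullback_colors g G) (pullback_colors g H) e (w \o h)).
  by split=> // u x; apply: ec.
by move=> i y; apply: im.
Qed.

Lemma env2_0 (V : Type) (x y : V) : env2 x y ord0 = x.
Proof. exact: env_cons0. Qed.

Lemma env2_1 (V : Type) (x y : V) : env2 x y ord_max = y.
Proof.
have -> : ord_max = lift ord0 ord0 :> 'I_2 by apply: val_inj.
exact: env_consS.
Qed.

Lemma ord2P (i : 'I_2) : (i == ord0) || (i == ord_max).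
Proof. by case: i => [[|[|]]]. Qed.

Lemma eq_env2 (V : Type) (x y : V) w :
  w ord0 = x -> w ord_max = y -> w =1 env2 x y.
Proof.
by move=> w0 w1 i; case/orP: (ord2P i) => /eqP->; rewrite ?env2_0 ?env2_1.
Qed.

(** An interpretation must give a graph under every coloring, also under one guessed wrongly, so
    symmetry and irreflexivity are forced by the syntax. *)
Definition symmetrize U (f : formula U 2) : formula U 2 :=
  FAnd (FNot (FEq ord0 ord_max)) (FOr f (remap id f (@rev_ord 2))).

Lemma sat_symmetrize U (f : formula U 2) (G : cgraph U) (x y : G) :
  sat (symmetrize f) (env2 x y) =
  (x != y) && (sat f (env2 x y) || sat f (env2 y x)).
Proof.
rewrite -[LHS]/(~~ (_ == _) && sat (FOr _ _) _) env2_0 env2_1 sat_or.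
congr (_ && (_ || _)); rewrite sat_remap_id.
apply: eq_sat; apply: eq_env2 => /=.
  by rewrite (_ : rev_ord _ = ord_max) ?env2_1 //; apply: val_inj.
by rewrite (_ : rev_ord _ = ord0) ?env2_0 //; apply: val_inj.
Qed.

Lemma symmetrize_sym U (f : formula U 2) (G : cgraph U) :
  symmetric (fun x y : G => sat (symmetrize f) (env2 x y)).
Proof. by move=> x y; rewrite !sat_symmetrize eq_sym orbC. Qed.

Lemma symmetrize_irr U (f : formula U 2) (G : cgraph U) :
  irreflexive (fun x y : G => sat (symmetrize f) (env2 x y)).
Proof. by move=> x; rewrite sat_symmetrize eqxx. Qed.

Lemma strongly_local_symmetrize U (f : formula U 2) d r : local r f ->
  (forall (G : cgraph U) (x y : G), sat f (env2 x y) -> dst d x y) ->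
  strongly_local (symmetrize f).
Proof.
move=> lf fd; exists (maxn r d); split.
  have lf' := local_mono (leq_maxl r d) lf.
  apply/local_ball/local_and; first exact/local_not/local_eq.
  by apply: local_or => //; apply: local_remap.
move=> G v; rewrite (eq_sat _ (eq_env2 (erefl (v ord0)) (erefl (v ord_max)))).
rewrite sat_symmetrize => /andP[_ fv] i j.
have {fv}: dst (maxn r d) (v ord0) (v ord_max).
  apply: dst_mono (leq_maxr _ _) _.
  by case/orP: fv => /fd //; rewrite dst_sym.
by case/orP: (ord2P i) => /eqP->; case/orP: (ord2P j) => /eqP-> // /dst_dist_le.
Qed.

(** * Perturbations that toggle a relation between vertex classes *)

Section Perturbation.

(** The net effect of successive complementations on a pair of classes. The diagonal counts, since
    distinct vertices may share a class. *)
Definition toggle_sets (C : finType) (As : seq {set C}) c d :=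
  \big[addb/false]_(A <- As) ((c \in A) && (d \in A)).

Lemma toggle_sets_sym (C : finType) (As : seq {set C}) :
  symmetric (toggle_sets As).
Proof. by move=> c d; apply: eq_bigr => A _; rewrite andbC. Qed.

(* The pair [{a, b}] is toggled by complementing [{a, b}], [{a}] and [{b}]. *)
Lemma symmetric_toggle_sets (C : finType) : exists n, forall R : rel C,
  symmetric R -> exists2 As, size As = n & R =2 toggle_sets As.
Proof.
suff [n H] : exists n, forall R : rel C, symmetric R ->
    (forall c d, R c d -> (c, d) \in enum {: C * C}) ->
    exists2 As, size As = n & R =2 toggle_sets As.
  by exists n => R Rs; apply: H => // c d _; rewrite mem_enum.
elim: (enum _) => [|[a b] s [n IH]].
  exists 0 => R _ R0; exists [::] => // c d; rewrite /toggle_sets big_nil.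
  by apply/negP => /R0.
exists n.+3 => R Rs Rab.
pose ab c d := (c == a) && (d == b) || (c == b) && (d == a).
have abs : symmetric ab.
  by move=> c d; rewrite /ab orbC andbC [X in _ || X]andbC.
have [|c d|As szAs RAs] := IH (fun c d => R c d && ~~ ab c d).
- by move=> c d; rewrite Rs abs.
- case/andP=> /Rab; rewrite inE => /orP[/eqP[-> ->]|//].
  by rewrite /ab !eqxx.
(* All three sets are empty unless [R a b], which keeps their number independent of [R]. For [a = b]
   they coincide, and three toggles amount to one. *)
exists [:: [set x | R a b & (x == a) || (x == b)], [set x | R a b & x == a],
   [set x | R a b & x == b] & As]; first by rewrite /= szAs.
move=> c d; rewrite /toggle_sets !big_cons -/(toggle_sets As c d) -RAs !inE /ab.
have [Rab1|nRab] := boolP (R a b); last first.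
  rewrite /=; have [/andP[/eqP-> /eqP->]|_] := boolP ((c == a) && (d == b)).
    by rewrite (negPf nRab).
  have [/andP[/eqP-> /eqP->]|_] := boolP ((c == b) && (d == a)).
    by rewrite Rs (negPf nRab).
  by rewrite /= andbT.
have [-> |ca] := eqVneq c a; have [-> |da] := eqVneq d a.
- have [ab1|_] := eqVneq a b; last by case: (R a a).
  by move: Rab1; rewrite -ab1 => ->.
- have [db|_] := eqVneq d b; last by case: (a == b); case: (R a d).
  by move: da; rewrite db eq_sym => /negPf ->; rewrite Rab1.
- have [cb|_] := eqVneq c b; last by case: (a == b); case: (R c a).
  by move: ca; rewrite cb eq_sym => /negPf ->; rewrite Rs Rab1.
- by case: (c == b); case: (d == b); case: (R c d).
Qed.

Section Toggle.
Variables (G : graph) (R : rel G) (R_sym : symmetric R).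

Definition toggle_adj : rel G := fun x y => (x != y) && (adj x y (+) R x y).

Lemma toggle_adj_sym : symmetric toggle_adj.
Proof. by move=> x y; rewrite /toggle_adj eq_sym adj_sym R_sym. Qed.

Lemma toggle_adj_irr : irreflexive toggle_adj.
Proof. by move=> x; rewrite /toggle_adj eqxx. Qed.

Definition toggle : graph := Graph toggle_adj_sym toggle_adj_irr.

End Toggle.

(** The vertices of [copy 1 G] are pairs, so it is [G] only up to the first projection. *)
Lemma transduction1_intro U (I : interpretation U) (G : cgraph U) H :
  isomorphic (interp I G) H -> transduction_op 1 I G H.
Proof.
move=> GH; exists (underlying G); last by exists G.
exists fst; last by move=> [x i] [y j]; rewrite /= /copy_adj !ord1 eqxx.
exists (fun x => (x, ord0)) => [[x i]|//].
by rewrite /= ord1.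
Qed.

Lemma subset_complementation_intro (G H : graph) (f : G -> H) (M : {set G}) :
  bijective f ->
  (forall x y, adj (f x) (f y) =
     (x != y) && (adj x y (+) (x \in M) && (y \in M))) ->
  subset_complementation G H.
Proof.
case=> f' fK f'K fadj; pose Gc := @CGraph unit G (fun=> M).
apply: (@transduction1_intro _ compl_interp Gc).
exists (fun a => f (val a)).
  pose g y : interp_vertex compl_interp Gc := Sub (f' y) (erefl true).
  exists g => x.
    by apply: val_inj; rewrite SubK fK.
  by rewrite SubK f'K.
move=> x y; rewrite fadj -[RHS]/(sat compl_eta (env2 (val x) (val y))).
by rewrite sat_compl_eta negb_eqb.
Qed.

(** Complementing leaves the vertices unchanged, so all sets can be fixed beforehand as preimages
    under [c]. Only the outermost step carries the bijection [f]; the graphs before it live on the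
    vertices of [G]. *)
Lemma iter_complementation_intro (C : finType) (As : seq {set C})
    (G H : graph) (f : G -> H) (c : G -> C) : bijective f ->
  (forall x y, adj (f x) (f y) =
     (x != y) && (adj x y (+) toggle_sets As (c x) (c y))) ->
  iter_complementation (size As) G H.
Proof.
elim: As H f => [|A As IH] H f fbij fadj.
  exists f => // x y; rewrite fadj /toggle_sets big_nil addbF.
  by have [->|] := eqVneq; rewrite ?adj_irr.
have Rs : symmetric (fun x y : G => toggle_sets As (c x) (c y)).
  by move=> x y; apply: toggle_sets_sym.
exists (toggle Rs).
  by apply: (IH _ (id : G -> toggle Rs)) => //; exists id.
pose M := [set x : toggle Rs | c x \in A].
apply: (@subset_complementation_intro (toggle Rs) H f M) => //.
move=> x y; rewrite fadj /= /toggle_adj !inE /toggle_sets big_cons.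
case: eqP => //= _.
by rewrite addbCA addbC.
Qed.

End Perturbation.

(* [None] marks the vertices kept by nu, [Some (inl u)] are the original colors,
   and [Some (inr b)] at [x] says that the pairs [(x, y)] of type [b] are edges. *)
Definition flag_color (U : Type) (B : Type) := option (U + B)%type.

(** * The immersive transduction with guessed flags *)

Section Flags.
Variables (U : Type) (T : finType) (F : T -> formula U 2) (d : nat).
Let B : finType := {ffun T -> bool}.

(** The distance conjunct bounds the reach under every coloring, as strong locality demands, and not
    only under a [flagging]. *)
Definition flagged_eta : formula (flag_color U B) 2 :=
  FAnd (FDist _ d ord0 ord_max) (FSome (fun b : B =>
    FAnd (FCol (Some (inr b)) ord0)
         (FType (fun t => remap (fun u => Some (inl u)) (F t) id) b))).

Definition flagged_interp : interpretation (flag_color U B) :=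
  @Interpretation _ (FCol None ord0) (symmetrize flagged_eta)
    (symmetrize_sym flagged_eta) (symmetrize_irr flagged_eta).

Lemma flagged_immersive r : (forall t, local r (F t)) ->
  strongly_local (nu flagged_interp) /\ strongly_local (eta flagged_interp).
Proof.
move=> lF; split.
  exists 0; split; first exact/local_ball/local_col.
  by move=> G v _ i j; rewrite !ord1.
apply: (@strongly_local_symmetrize _ _ d (maxn d r)).
  apply: local_and; first exact/local_dist/leq_maxl.
  apply: local_some => b; apply: local_and; first exact: local_col.
  apply: local_type => t; apply: local_remap.
  exact: local_mono (leq_maxr _ _) (lF t).
by move=> G x y; rewrite sat_and => /andP[]; rewrite sat_dist env2_0 env2_1.
Qed.

Variables (G : graph) (c : U -> {set G}) (N : pred G) (H : rel G).
Let K := CGraph c.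

Definition flagging : cgraph (flag_color U B) :=
  @CGraph (flag_color U B) G (fun u => match u with
    | None => [set x | N x]
    | Some (inl u) => c u
    | Some (inr b) => [set x | [exists y,
        [&& dst d x y, sat_type (G := K) F (env2 x y) == b & H x y]]]
    end).

Hypotheses (H_sym : symmetric H) (H_dst : forall x y, H x y -> dst d x y).
Hypothesis H_type : forall x y x' y',
  sat_type (G := K) F (env2 x y) = sat_type (G := K) F (env2 x' y') ->
  H x y = H x' y'.

(** A flag for type [b] at [u] comes from some [z] with [H u z] and [(u, z)] of type [b]. As [H]
    depends on the type alone, it then holds for every [w] such that [(u, w)] has type [b]. *)
Lemma sat_flagged_eta (x y : G) :
  sat (G := flagging) (eta flagged_interp) (env2 x y) = (x != y) && H x y.
Proof.
suff sub u w : @sat _ flagging _ flagged_eta (env2 u w) = H u w.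
  by rewrite sat_symmetrize !sub (H_sym y) orbb.
rewrite sat_and sat_dist env2_0 env2_1 sat_some.
apply/andP/idP => [[_ /existsP[b]]|uw].
  rewrite sat_and sat_FType /= env2_0 inE.
  move=> /andP[/existsP[z /and3P[_ /eqP <- uz]] /eqP/ffunP uwz].
  suff -> : H u w = H u z by []; apply: H_type; apply/ffunP => t.
  by have := uwz t; rewrite !ffunE sat_remap.
split; first exact: H_dst.
apply/existsP; exists (sat_type (G := K) F (env2 u w)).
rewrite sat_and sat_FType /= env2_0 inE; apply/andP; split.
  by apply/existsP; exists w; rewrite H_dst // eqxx.
by apply/eqP/ffunP => t; rewrite !ffunE sat_remap.
Qed.

End Flags.


(** * Splitting a formula into far and near parts, and the subsumption *)

Lemma game_env1 (G : graph) P D k (x x' : G) :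
  game P D k (pairs (env1 x) (env1 x')) -> game P D k [:: (x, x')].
Proof.
move=> g; apply: game_mono g => // p; rewrite inE => /eqP->.
exact: (mem_pairs (env1 x) (env1 x') ord0).
Qed.

Lemma game_env2 (G : graph) P D k (x x' y y' : G) :
  apart (D * k.+1) [:: (x, x')] [:: (y, y')] ->
  game P D k [:: (x, x')] -> game P D k [:: (y, y')] ->
  game P D k (pairs (env2 x y) (env2 x' y')).
Proof.
move=> xy gx gy; apply: game_mono (game_cat xy gx gy) => // p.
by rewrite !inE => /codomP[i ->]; case/orP: (ord2P i) => /eqP->;
  rewrite ?env2_0 ?env2_1 eqxx ?orbT.
Qed.

(** By [game_cat], far pairs whose ends have the same types agree on [f], so [R] can be read off
    from any far pair. The formulas and radii come from [f] alone; only [R] depends on the graph. *)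
Lemma far_near_decomposition U (f : formula U 2) :
  (forall G : cgraph U, symmetric (fun x y : G => sat f (env2 x y))) ->
  exists (T1 T : finType) (F1 : T1 -> formula U 1) (F : T -> formula U 2) d r,
  (forall t, local r (F t)) /\ forall G : cgraph U,
  exists2 R : rel {ffun T1 -> bool}, symmetric R &
  let H (x y : G) :=
    sat f (env2 x y) (+) R (sat_type F1 (env1 x)) (sat_type F1 (env1 y)) in
  (forall x y, H x y -> dst d x y) /\
  (forall x y x' y', sat_type F (env2 x y) = sat_type F (env2 x' y') ->
     H x y = H x' y').
Proof.
move=> f_sym; have [cs [D [k fP]]] := sat_game f.
have [T1 [F1 [r1 [lF1 F1P]]]] := game_local cs D k 1.
have [T2 [F2 [r2 [lF2 F2P]]]] := game_local cs D k 2.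
(* Pair types also record the type of each end, because the remainder depends on [R] as well as on
   [f]. *)
pose F (t : T2 + (T1 + T1)) := match t with
  | inl t => F2 t
  | inr (inl t) => remap id (F1 t) (fun=> ord0)
  | inr (inr t) => remap id (F1 t) (fun=> ord_max)
  end.
exists T1, (T2 + (T1 + T1))%type, F1, F, (D * k.+1), (maxn r1 r2); split.
  case=> [t|[t|t]]; first exact: local_mono (leq_maxr _ _) (lF2 t).
    exact/local_remap/(local_mono (leq_maxl _ _)).
  exact/local_remap/(local_mono (leq_maxl _ _)).
move=> G; pose tp (x : G) := sat_type F1 (env1 x).
pose R b b' := [exists x, exists y, [&& ~~ dst (D * k.+1) x y, tp x == b,
  tp y == b' & sat f (env2 x y)]].
have Rsub b b' : R b b' -> R b' b.
  case/existsP=> x /existsP[y /and4P[xy xb yb' fxy]].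
  apply/existsP; exists y; apply/existsP; exists x.
  by rewrite dst_sym xy xb yb' /= -f_sym.
exists R => [b b'|H]; first by apply/idP/idP => /Rsub.
split=> [x y|x y x' y' /ffunP E].
  apply: contraTT => xy; rewrite /H -negb_eqb negbK.
  have H1 : sat f (env2 x y) -> R (tp x) (tp y).
    move=> fxy; apply/existsP; exists x; apply/existsP; exists y.
    by rewrite xy !eqxx.
  have H2 : R (tp x) (tp y) -> sat f (env2 x y).
    (* The far pair witnessing [R] has the same end types as [(x, y)], so the games at the two ends
       combine and transfer [f]. *)
    case/existsP=> x' /existsP[y' /and4P[xy' /eqP xx /eqP yy fxy]].
    rewrite (fP _ _ (env2 x' y')) //; apply: game_env2.
    - by move=> p q /[!inE] /eqP-> /eqP->; rewrite xy xy'.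
    - by apply/game_env1/F1P.
    - by apply/game_env1/F1P.
  by apply/eqP; apply/idP/idP.
have at0 (u w : G) t : sat (F (inr (inl t))) (env2 u w) = sat (F1 t) (env1 u).
  by rewrite sat_remap_id; apply: eq_sat => i /=; rewrite env2_0.
have at1 (u w : G) t : sat (F (inr (inr t))) (env2 u w) = sat (F1 t) (env1 w).
  by rewrite sat_remap_id; apply: eq_sat => i /=; rewrite env2_1.
have E1 : sat_type F1 (env1 x) = sat_type F1 (env1 x').
  by apply/ffunP => t; have := E (inr (inl t)); rewrite !ffunE !at0.
have E2 : sat_type F1 (env1 y) = sat_type F1 (env1 y').
  by apply/ffunP => t; have := E (inr (inr t)); rewrite !ffunE !at1.
rewrite /H E1 E2; congr addb; apply/fP/F2P/ffunP => t.
by have := E (inl t); rewrite !ffunE.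
Qed.

(** The flags define the remainder [K], which is [eta] xored with [R]; complementing unions of type
    classes xors [R] back in. *)
Lemma non_copying_subsumed U (I : interpretation U) :
  exists U' (I' : interpretation U') n,
    [/\ strongly_local (nu I'), strongly_local (eta I')
      & subsumed (transduction_op 1 I)
          (iter_complementation n ∘ transduction_op 1 I')].
Proof.
have [T1 [T [F1 [F [d [r [lF dec]]]]]]] :=
  far_near_decomposition (@eta_sym U I).
have [n symP] := symmetric_toggle_sets {ffun T1 -> bool}.
have [lnu leta] := flagged_immersive d lF.
exists _, (flagged_interp F d), n; split=> //.
move=> G0 H [G1 + [[G c] GG1 [f fbij fadj]]].
move: GG1; rewrite /coloring_op => <- G01.
have [R R_sym] := dec (CGraph c); set K := fun x y => _ => -[K_dst K_type].
have [As szAs RAs] := symP R R_sym.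
pose N (x : G) := @sat _ (CGraph c) _ (nu I) (env1 x).
pose G' := flagging F d c N K.
have K_sym : symmetric K by move=> x y; rewrite /K eta_sym R_sym.
exists (interp (flagged_interp F d) G').
  exists G; first by [].
  exists G' => //; exists id => //; exact: (inv_bij (fun=> erefl)).
have nuE x : @sat _ G' _ (nu (flagged_interp F d)) (env1 x) = N x.
  by rewrite /= inE.
pose h (a : interp (flagged_interp F d) G') : interp I (CGraph c) :=
  Sub (val a) (etrans (esym (nuE _)) (valP a)).
(* The classes are types in the whole colored graph, although the complementations act only on the
   vertices kept by [nu]. *)
rewrite -szAs; apply: (@iter_complementation_intro _ _ _ _ (f \o h)
  (fun a => @sat_type U 1 T1 F1 (CGraph c) (env1 (val a)))).
  apply: bij_comp => //.
  exists (fun b => Sub (val b) (etrans (nuE _) (valP b))).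
    by move=> a; apply: val_inj; rewrite !SubK.
  by move=> b; apply: val_inj; rewrite !SubK.
move=> a b; rewrite /= fadj /= /interp_adj sat_flagged_eta // -RAs /K !SubK.
have [->|] /= := eqVneq a b; last by rewrite -val_eqE => ->; rewrite addbK.
by rewrite eta_irr.
Qed.

Theorem theorem5p3 :
  (forall T : operation, non_copying T ->
     exists Timm P : operation,
       [/\ immersive Timm, perturbation P & subsumed T (P ∘ Timm)])
  /\
  (forall T : operation, transduction T ->
     exists C Timm P : operation,
       [/\ copying_operation C, immersive Timm, perturbation P
         & subsumed T (P ∘ Timm ∘ C)]).
Proof.
have main U (I : interpretation U) : exists Timm P : operation,
    [/\ immersive Timm, perturbation P
      & subsumed (transduction_op 1 I) (P ∘ Timm)].
  have [U' [I' [n [lnu leta sub]]]] := non_copying_subsumed I.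
  exists (transduction_op 1 I'), (iter_complementation n); split=> //.
    by exists U', I'.
  by exists n.
split=> [T [U [I TI]]|T [k [U [I [k_gt0 TI]]]]];
  have [Timm [P [imm pert sub]]] := main U I.
  by exists Timm, P; split=> // G H /TI /sub.
exists (copy_op k), Timm, P; split=> //; first by exists k.
(* After copying, what remains is a non-copying transduction applied to [G1]. *)
move=> G H /TI[G1 G01 [Gc /= GcG1 GcH]]; exists G1 => //.
by apply: sub; rewrite -GcG1; apply: transduction1_intro.
Qed.
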